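(* Let $\lambda\in\mathbf{C}$ with $\lambda\neq 1$. For all integers $n\ge 0$ and $r\ge 0$, $$\frac{r!}{(1-\lambda)^r}S_\lambda(n,r)=\frac{r!}{(1-\lambda)^r}\,\frac{\tilde{\triangle}_\lambda^r0^n}{r!}$$ $$=\sum_{l=0}^{\min\{2r,n\}}\left\{\binom{n}{l}\sum_{m=0}^{l}\frac{\binom{2r}{m}}{(1-\lambda)^m}\sum_{\substack{k_1+\cdots+k_m=l\\ k_j\ge 1}}\binom{l}{k_1,\dots,k_m}\right\}H_{n-l}^{(r)}(\lambda)$$ $$\quad+\sum_{l=\min\{2r,n\}+1}^{n}\left\{\binom{n}{l}\sum_{m=0}^{\min\{2r,n\}}\frac{\binom{2r}{m}}{(1-\lambda)^m}\sum_{\substack{k_1+\cdots+k_m=l\\ k_j\ge 1}}\binom{l}{k_1,\dots,k_m}\right\}H_{n-l}^{(r)}(\lambda)$$ $$=\sum_{m=0}^{\min\{r,n\}}\frac{\binom{r}{m}}{(1-\lambda)^m}\sum_{\substack{k_1+\cdots+k_m=n\\ k_j\ge 1}}\binom{n}{k_1,\dots,k_m}.$$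
   Context: The Frobenius-Euler numbers of order $r$ ($r$ a nonnegative integer), $H_n^{(r)}(\lambda)$, are defined by the formal power series identity $\left(\frac{1-\lambda}{e^t-\lambda}\right)^r=\sum_{n=0}^\infty H_n^{(r)}(\lambda)\frac{t^n}{n!}$. The analogue of the Stirling numbers of the second kind is $S_\lambda(n,k)=\frac{1}{k!}\sum_{j=0}^{k}\binom{k}{j}(-\lambda)^{k-j}j^n$ for $n,k\ge 0$, with $0^0=1$. The operator $\tilde{\triangle}_\lambda$ acts on functions by $\tilde{\triangle}_\lambda f(x)=f(x+1)-\lambda f(x)$, and $\tilde{\triangle}_\lambda^r0^n$ denotes the value at $x=0$ of $\tilde{\triangle}_\lambda^r$ applied to $f(x)=x^n$. The innermost sums run over $m$-tuples $(k_1,\dots,k_m)$ of positive integers with the indicated sum, and $\binom{l}{k_1,\dots,k_m}=\frac{l!}{k_1!\cdots k_m!}$. For $m=0$ such a sum over tuples with total $l$ equals $1$ if $l=0$ and $0$ if $l\ge 1$ (likewise with $n$ in place of $l$). A sum whose lower limit exceeds its upper limit is $0$. *)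

(* Defs.v *)
From HB Require Import structures.
From mathcomp Require Import all_boot all_order all_algebra.
From mathcomp Require Export complex.
From mathcomp Require Import boolp.
From mathcomp Require Export reals.

Set Implicit Arguments.
Unset Strict Implicit.
Unset Printing Implicit Defensive.

Import Order.TTheory GRing.Theory Num.Theory.

Local Open Scope ring_scope.

(* The formal power series \sum_n a_n t^n is represented by n |-> a_n. *)
Record fps (F : fieldType) := FPS { coefs :> nat -> F }.

Section FormalPowerSeries.
Variable F : fieldType.
Implicit Types (f g h : fps F) (n : nat).

Lemma fpsP f g : (forall n, f n = g n) <-> f = g.
Proof.
split=> [|-> //]; case: f g => [a] [b] /= eq_ab.
by congr FPS; apply/funext.
Qed.

HB.instance Definition _ := gen_eqMixin (fps F).
HB.instance Definition _ := gen_choiceMixin (fps F).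

Definition fps_zero : fps F := FPS (fun=> 0).
Definition fps_opp f : fps F := FPS (fun n => - f n).
Definition fps_add f g : fps F := FPS (fun n => f n + g n).

Fact fps_addA : associative fps_add.
Proof. by move=> f g h; apply/fpsP=> n; rewrite /= addrA. Qed.
Fact fps_addC : commutative fps_add.
Proof. by move=> f g; apply/fpsP=> n; rewrite /= addrC. Qed.
Fact fps_add0 : left_id fps_zero fps_add.
Proof. by move=> f; apply/fpsP=> n; rewrite /= add0r. Qed.
Fact fps_addN : left_inverse fps_zero fps_opp fps_add.
Proof. by move=> f; apply/fpsP=> n; rewrite /= addNr. Qed.

HB.instance Definition _ :=
  GRing.isZmodule.Build (fps F) fps_addA fps_addC fps_add0 fps_addN.

Definition fpsC (a : F) : fps F := FPS (fun n => a *+ (n == 0)%N).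
Definition fps_mul f g : fps F :=
  FPS (fun n => \sum_(i < n.+1) f i * g (n - i)%N).

Let trunc N f : {poly F} := \poly_(i < N) f i.

Let coef_trunc_mul N f g n : (n < N)%N ->
  (trunc N f * trunc N g)`_n = fps_mul f g n.
Proof.
move=> nN; rewrite coefM; apply: eq_bigr => i _; rewrite !coef_poly.
by rewrite (leq_ltn_trans _ nN) ?leq_ord// (leq_ltn_trans (leq_subr _ _) nN).
Qed.

Fact fps_mulC : commutative fps_mul.
Proof.
move=> f g; apply/fpsP=> n.
by rewrite -!(coef_trunc_mul _ _ (ltnSn n)) mulrC.
Qed.

Fact fps_mulA : associative fps_mul.
Proof.
move=> f g h; apply/fpsP=> n.
have L : fps_mul f (fps_mul g h) n
    = (trunc n.+1 f * (trunc n.+1 g * trunc n.+1 h))`_n.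
  rewrite coefM; apply: eq_bigr => i _.
  by rewrite coef_trunc_mul ?ltnS ?leq_subr// coef_poly ltn_ord.
have -> : fps_mul (fps_mul f g) h n
    = (trunc n.+1 f * trunc n.+1 g * trunc n.+1 h)`_n.
  rewrite coefM; apply: eq_bigr => i _.
  by rewrite coef_trunc_mul ?ltn_ord// coef_poly ltnS leq_subr.
by rewrite L mulrA.
Qed.

Fact fps_mul1 : left_id (fpsC 1) fps_mul.
Proof.
move=> f; apply/fpsP=> n /=; rewrite big_ord_recl /= subn0 mul1r.
by rewrite big1 ?addr0// => i _; rewrite mul0r.
Qed.

Fact fps_mulDl : left_distributive fps_mul fps_add.
Proof.
move=> f g h; apply/fpsP=> n /=; rewrite -big_split /=.
by apply: eq_bigr => i _; rewrite mulrDl.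
Qed.

Fact fps_one_neq0 : fpsC 1 != 0.
Proof. by apply/eqP=> /fpsP/(_ 0)/eqP; rewrite /= oner_eq0. Qed.

HB.instance Definition _ := GRing.Zmodule_isComNzRing.Build (fps F)
  fps_mulA fps_mulC fps_mul1 fps_mulDl fps_one_neq0.

Lemma coefsM f g n : (f * g) n = \sum_(i < n.+1) f i * g (n - i)%N.
Proof. by []. Qed.

Definition fps_unit : {pred fps F} := fun f => f 0 != 0.

(* The first n coefficients of the inverse of f, obtained by solving
   \sum_(i <= m) b_i * f (m - i) = (m == 0) for b_m. *)
Fixpoint fps_inv_seq f n : seq F :=
  if n is m.+1 then
    let b := fps_inv_seq f m in
    rcons b (((m == 0)%N%:R - \sum_(i < m) b`_i * f (m - i)%N) / f 0)
  else [::].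

Definition fps_inv f : fps F :=
  if f \in fps_unit then FPS (fun n => (fps_inv_seq f n.+1)`_n) else f.

Let size_inv_seq f n : size (fps_inv_seq f n) = n.
Proof. by elim: n => //= n IHn; rewrite size_rcons IHn. Qed.

Let nth_inv_seq f n m : (m < n)%N ->
  (fps_inv_seq f n)`_m = (fps_inv_seq f m.+1)`_m.
Proof.
elim: n => // n IHn; rewrite ltnS leq_eqVlt => /predU1P[-> //|mn].
by rewrite [LHS]/= nth_rcons size_inv_seq mn IHn.
Qed.

Fact fps_mulV : {in fps_unit, left_inverse 1 fps_inv *%R}.
Proof.
move=> f uf; apply/fpsP=> n; rewrite coefsM /fps_inv uf big_ord_recr /= subnn.
rewrite nth_rcons size_inv_seq ltnn eqxx divfK//.
rewrite (eq_bigr (fun i : 'I_n => (fps_inv_seq f n)`_i * f (n - i)%N)).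
  by rewrite addrC subrK.
by move=> i _; rewrite [in RHS]nth_inv_seq.
Qed.

Fact fps_unitPl f g : g * f = 1 -> fps_unit f.
Proof.
move=> /fpsP/(_ 0); rewrite coefsM big_ord1 /= => gf1.
by apply/eqP=> f0; move/eqP: gf1; rewrite f0 mulr0 eq_sym oner_eq0.
Qed.

Fact fps_inv_out : {in [predC fps_unit], fps_inv =1 id}.
Proof. by move=> f; rewrite inE /= /fps_inv => /negbTE->. Qed.

HB.instance Definition _ := GRing.ComNzRing_hasMulInverse.Build (fps F)
  fps_mulV fps_unitPl fps_inv_out.

Lemma fps_unitE f : (f \is a GRing.unit) = (f 0 != 0).
Proof. by []. Qed.

Definition fps_exp : fps F := FPS (fun n => n`!%:R^-1).

End FormalPowerSeries.

Section FrobeniusEuler.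
Variable F : fieldType.
Implicit Types (lambda : F) (f : F -> F) (l m n k r : nat).

Definition frobenius_euler_series lambda : fps F :=
  fpsC (1 - lambda) / (fps_exp F - fpsC lambda).

Definition frobenius_euler r n lambda : F :=
  n`!%:R * (frobenius_euler_series lambda ^+ r) n.

Definition stirling lambda n k : F :=
  k`!%:R^-1 *
  \sum_(0 <= j < k.+1) 'C(k, j)%:R * (- lambda) ^+ (k - j) * j%:R ^+ n.

Definition delta lambda f : F -> F := fun x => f (x + 1) - lambda * f x.

(* The sum of l! / (k_1! ... k_m!) over the m-tuples of positive integers with
   total l; the bound k_j <= l implied by the total makes the range finite. *)
Definition multinomial_sum m l : F :=
  \sum_(k : {ffun 'I_m -> 'I_l.+1}
        | [forall j, (0 < k j)%N] && (\sum_(j < m) k j == l)%N)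
    l`!%:R / \prod_(j < m) (k j)`!%:R.

Lemma multinomial_sum0 l : multinomial_sum 0 l = (l == 0)%N%:R.
Proof.
rewrite /multinomial_sum.
under eq_bigr do rewrite big_ord0 divr1.
under eq_bigl => k.
  rewrite big_ord0 eq_sym (_ : [forall _, _]) /=; last by apply/forallP=> -[].
  over.
case: l => [|l] /=; last by rewrite big_pred0.
by rewrite big_const card_ffun !card_ord expn0 /= addr0.
Qed.

End FrobeniusEuler.

Lemma frobenius_euler_genE (F : numFieldType) (lambda : F) r :
  lambda != 1 ->
  (fps_exp F - fpsC lambda \is a GRing.unit) /\
  frobenius_euler_series lambda ^+ r
    = FPS (fun n => frobenius_euler r n lambda / n`!%:R).
Proof.
move=> l1; split.
  by rewrite fps_unitE /= invr1 mulr1n subr_eq0 eq_sym.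
apply/fpsP=> n /=; rewrite /frobenius_euler mulrC mulKf//.
by rewrite pnatr_eq0 -lt0n fact_gt0.
Qed.

(* Main.v *)
Require Import Defs.
From mathcomp Require Import all_boot all_order all_algebra.
From mathcomp Require Import complex reals.

(** Every quantity in the statement is [n!] times the [n]-th coefficient of a
    power of one formal power series.  Put [E = exp t] and
    [u = (E - lambda) / (1 - lambda) = 1 + (E - 1) / (1 - lambda)]; all the
    members of the chain are [n!] times the coefficient of [t^n] in [u ^+ r].

    - The operator [delta lambda] multiplies the exponential [exp (x t)], seen
      as the generating function of the powers of [x], by [E - lambda].
      Iterating it and setting [x = 0] gives [(E - lambda) ^+ r]
      ([iter_delta_power]), and the binomial expansion of this power is the
      sum that defines the Stirling numbers ([stirling_delta]).
    - The multinomial sums over [m]-tuples of positive integers are the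
      coefficients of [(E - 1) ^+ m] ([multinomial_sumE]).  The binomial
      expansion of [(1 + (E - 1) / (1 - lambda)) ^+ s] thus expresses the
      coefficients of [u ^+ s] by these sums ([frobenius_powerE]); with
      [s = r] this is the last member of the chain.
    - The Frobenius-Euler series is [u^-1], so [u ^+ r] is the product of
      [u ^+ (2 * r)] and the [r]-th power of the Frobenius-Euler series; taking
      coefficients gives the middle member.

    The various upper limits for [m] are all harmless for one reason: the term
    of index [m] vanishes when [m] exceeds the exponent [s], because of the
    binomial coefficient, and when [m] exceeds the total [l], because there is
    no [m]-tuple of positive integers with total [l]. *)

Set Implicit Arguments.
Unset Strict Implicit.
Unset Printing Implicit Defensive.

Import Order.TTheory GRing.Theory Num.Theory.

Local Open Scope ring_scope.

(** * Coefficients of formal power series *)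

Section Coefficients.
Variable F : fieldType.
Implicit Types (f g : fps F) (a b : F) (n m N : nat).

Lemma coefsB f g n : (f - g) n = f n - g n.
Proof. by []. Qed.

Lemma coefs_sum I (s : seq I) (P : pred I) (G : I -> fps F) n :
  (\sum_(i <- s | P i) G i) n = \sum_(i <- s | P i) G i n.
Proof. exact: (big_morph (fun f : fps F => f n)). Qed.

Lemma coefsMn f k n : (f *+ k) n = f n *+ k.
Proof. by rewrite -[k]card_ord -!sumr_const coefs_sum. Qed.

Lemma coefsCM a f n : (fpsC a * f) n = a * f n.
Proof.
rewrite coefsM big_ord_recl /= subn0 mulr1n big1 ?addr0// => i _.
by rewrite mulr0n mul0r.
Qed.

Lemma fpsCM a b : fpsC (a * b) = fpsC a * fpsC b.
Proof. by apply/fpsP => n; rewrite coefsCM /= mulrnAr. Qed.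

Lemma fpsCB a b : fpsC (a - b) = fpsC a - fpsC b.
Proof. by apply/fpsP => n; rewrite coefsB /= mulrnBl. Qed.

Lemma fpsCX a k : fpsC (a ^+ k) = fpsC a ^+ k.
Proof. by elim: k => // k IHk; rewrite !exprS fpsCM IHk. Qed.

(** A coefficient of a power only involves the coefficients of at most the same
    index, so that it can be computed with polynomials. *)
Lemma coefsX_poly f m N n : (n < N)%N ->
  (f ^+ m) n = ((\poly_(i < N) f i) ^+ m)`_n.
Proof.
elim: m n => [|m IHm] n nN; first by rewrite !expr0 coef1; case: n {nN}.
rewrite !exprS coefsM coefM; apply: eq_bigr => i _.
rewrite coef_poly (leq_ltn_trans _ nN) ?leq_ord// IHm//.
exact: leq_ltn_trans (leq_subr _ _) nN.
Qed.

Lemma coefsX f m n :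
  (f ^+ m) n =
  \sum_(k : {ffun 'I_m -> 'I_n.+1} | (\sum_(j < m) k j == n)%N)
    \prod_(j < m) f (k j).
Proof.
rewrite (coefsX_poly f m (ltnSn n)) poly_def -[m in LHS]card_ord -prodr_const.
rewrite bigA_distr_bigA coef_sum [RHS]big_mkcond; apply: eq_bigr => k _ /=.
rewrite scaler_prod prodrXr coefZ coefXn eq_sym.
by case: eqP => _; rewrite ?mulr1 ?mulr0.
Qed.

End Coefficients.

(** * Exponential series and the operator delta *)

Section Exponential.
Variable F : numFieldType.
Implicit Types (a b x lambda : F) (n m r s l : nat).

Lemma factF_neq0 n : n`!%:R != 0 :> F.
Proof. by rewrite pnatr_eq0 -lt0n fact_gt0. Qed.

(** The series of [exp (a t)]. *)
Definition fps_expM a : fps F := FPS (fun n => a ^+ n / n`!%:R).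

Lemma fps_expM0 : fps_expM 0 = 1.
Proof.
apply/fpsP => -[|n] /=; first by rewrite expr0 divr1.
by rewrite expr0n mul0r.
Qed.

Lemma fps_expM1 : fps_expM 1 = fps_exp F.
Proof. by apply/fpsP => n /=; rewrite expr1n mul1r. Qed.

(** Since [n! = 'C(n, i) * i! * (n - i)!], the normalization of exponential
    generating functions turns products into binomial convolutions. *)
Lemma fact_coefsM (f g : fps F) n :
  n`!%:R * (f * g) n =
  \sum_(i < n.+1) 'C(n, i)%:R * (i`!%:R * f i) * ((n - i)`!%:R * g (n - i)%N).
Proof.
rewrite coefsM mulr_sumr; apply: eq_bigr => i _.
rewrite -(bin_fact (leq_ord i)) !natrM -!mulrA; congr (_ * (_ * _)).
by rewrite mulrCA.
Qed.

Lemma fps_expMD a b : fps_expM (a + b) = fps_expM a * fps_expM b.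
Proof.
apply/fpsP => n; apply: (mulfI (factF_neq0 n)).
rewrite fact_coefsM /= mulrC divfK ?factF_neq0// addrC exprDn.
apply: eq_bigr => i _; rewrite -mulr_natl -mulrA; congr (_ * _).
rewrite [i`!%:R * _]mulrC [(n - i)`!%:R * _]mulrC.
by rewrite !divfK ?factF_neq0// mulrC.
Qed.

Lemma fps_expX j : fps_exp F ^+ j = fps_expM j%:R.
Proof.
elim: j => [|j IHj]; first by rewrite fps_expM0.
by rewrite exprSr IHj -fps_expM1 -fps_expMD natr1.
Qed.

(** The generating function of the powers of [x] is [exp (x t)], and shifting
    [x] by [1] multiplies it by [exp t]. *)
Lemma iter_delta_power lambda r n x :
  iter r (delta lambda) (fun y => y ^+ n) x =
  n`!%:R * ((fps_exp F - fpsC lambda) ^+ r * fps_expM x) n.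
Proof.
elim: r x => [|r IHr] x.
  by rewrite expr0 mul1r /= mulrC divfK ?factF_neq0.
rewrite iterS {1}/delta !IHr mulrCA -mulrBr; congr (_ * _).
rewrite fps_expMD fps_expM1 exprSr -coefsCM -coefsB; congr (coefs _ n).
rewrite [fpsC lambda * _]mulrCA -mulrBr -mulrA; congr (_ * _).
by rewrite mulrBl [fps_expM x * _]mulrC.
Qed.

Lemma iter_delta_power0 lambda r n :
  iter r (delta lambda) (fun y => y ^+ n) 0 =
  n`!%:R * ((fps_exp F - fpsC lambda) ^+ r) n.
Proof. by rewrite iter_delta_power fps_expM0 mulr1. Qed.

Lemma stirling_delta lambda n r :
  stirling lambda n r =
  iter r (delta lambda) (fun x => x ^+ n) 0 / r`!%:R.
Proof.
rewrite /stirling mulrC; congr (_ / _); rewrite iter_delta_power0.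
rewrite addrC exprDn coefs_sum mulr_sumr big_mkord; apply: eq_bigr => j _.
have -> : - fpsC lambda = fpsC (- lambda).
  by apply/fpsP => i /=; rewrite mulNrn.
rewrite coefsMn -fpsCX coefsCM fps_expX /= mulrnAr -[RHS]mulr_natl -mulrA.
congr (_ * _); rewrite mulrCA; congr (_ * _).
by rewrite mulrC divfK ?factF_neq0.
Qed.

(** * Multinomial sums and powers of the Frobenius series *)

(** The coefficient of the power is a sum over all tuples with total [l]; those
    with a zero entry contribute nothing, as [E - 1] has no constant term. *)
Lemma multinomial_sumE m l :
  multinomial_sum F m l = l`!%:R * ((fps_exp F - 1) ^+ m) l.
Proof.
rewrite coefsX mulr_sumr /multinomial_sum big_mkcond [RHS]big_mkcond /=.
apply: eq_bigr => k _; case: forallP => [k_gt0|k_n0] /=.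
  case: eqP => // _; rewrite -prodfV; congr (_ * _); apply: eq_bigr => j _.
  by rewrite eqn0Ngt k_gt0 subr0.
case: eqP => // _; have /existsP[j /eqP k0] : [exists j, k j == 0 :> nat].
  apply: contraT; rewrite negb_exists => /forallP k0.
  by case: k_n0 => j; rewrite lt0n k0.
by rewrite (bigD1 j)//= k0 invr1 subrr mul0r mulr0.
Qed.

Lemma multinomial_sum_eq0 m l : (l < m)%N -> multinomial_sum F m l = 0.
Proof.
move=> lm; rewrite /multinomial_sum big_pred0// => k.
apply/negP => /andP[/forallP k_gt0 /eqP sum_k].
have : (m <= l)%N.
  by rewrite -sum_k -[m in (m <= _)%N]card_ord -sum1_card leq_sum.
by rewrite leqNgt lm.
Qed.

(** The inverse of the Frobenius-Euler series. *)
Definition frobenius_series lambda : fps F :=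
  fpsC (1 - lambda)^-1 * (fps_exp F - fpsC lambda).

Section Neq1.
Variable lambda : F.
Hypothesis lambda1 : lambda != 1.

Let lambdaB_neq0 : 1 - lambda != 0.
Proof. by rewrite subr_eq0 eq_sym. Qed.

Lemma frobenius_seriesE :
  frobenius_series lambda = 1 + fpsC (1 - lambda)^-1 * (fps_exp F - 1).
Proof.
have {2}-> : (1 : fps F) = fpsC lambda + fpsC (1 - lambda).
  by rewrite fpsCB addrC subrK.
rewrite /frobenius_series opprD addrA [in RHS]mulrBr -fpsCM mulVf//.
by rewrite [RHS]addrC subrK.
Qed.

Lemma frobenius_seriesK :
  frobenius_series lambda * frobenius_euler_series lambda = 1.
Proof.
have [uE _] := frobenius_euler_genE 0 lambda1.
rewrite /frobenius_series /frobenius_euler_series mulrAC mulrA -fpsCM mulVf//.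
by rewrite mul1r mulVr.
Qed.

(** This is the binomial expansion of [(1 + (E - 1) / (1 - lambda)) ^+ s],
    whose natural upper limit for [m] is [s].  The terms beyond [minn s l]
    vanish, so the upper limit is left free in order to cover all the ranges
    that occur in the final chain. *)
Lemma frobenius_powerE s l N : (minn s l < N)%N ->
  \sum_(0 <= m < N) 'C(s, m)%:R / (1 - lambda) ^+ m * multinomial_sum F m l
  = l`!%:R * (frobenius_series lambda ^+ s) l.
Proof.
set T := fun m => 'C(s, m)%:R / (1 - lambda) ^+ m * multinomial_sum F m l.
have T0 m : (minn s l < m)%N -> T m = 0.
  rewrite gtn_min /T => /orP[sm|lm]; first by rewrite bin_small// !mul0r.
  by rewrite multinomial_sum_eq0// mulr0.
have T_min M : (minn s l < M)%N ->
    \sum_(0 <= m < M) T m = \sum_(0 <= m < (minn s l).+1) T m.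
  move=> sM; rewrite (big_cat_nat (n := (minn s l).+1))//=.
  rewrite [X in _ + X]big_nat_cond [X in _ + X]big1 ?addr0// => m.
  by rewrite andbT => /andP[+ _]; apply: T0.
move=> /T_min->; rewrite -(T_min s.+1) ?ltnS ?geq_minl//.
rewrite frobenius_seriesE exprDn coefs_sum mulr_sumr big_mkord.
apply: eq_bigr => m _; rewrite expr1n mul1r exprMn coefsMn -fpsCX coefsCM.
by rewrite /T multinomial_sumE exprVn mulrnAr -[RHS]mulr_natl -mulrA
  (mulrCA l`!%:R).
Qed.

Lemma frobenius_power_delta n r :
  r`!%:R / (1 - lambda) ^+ r
    * (iter r (delta lambda) (fun x => x ^+ n) 0 / r`!%:R)
  = n`!%:R * (frobenius_series lambda ^+ r) n.
Proof.
rewrite iter_delta_power0 exprMn -fpsCX coefsCM exprVn.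
by rewrite mulrC [LHS]mulrA divfK ?factF_neq0// -mulrA [X in _ * X]mulrC.
Qed.

(** With [u] the Frobenius series, whose inverse is the Frobenius-Euler series,
    this is [u ^+ r = u ^+ (2 * r) * (u^-1) ^+ r] on coefficients. *)
Lemma frobenius_power_euler n r :
  n`!%:R * (frobenius_series lambda ^+ r) n =
  \sum_(0 <= l < n.+1)
    ('C(n, l)%:R * (l`!%:R * (frobenius_series lambda ^+ (2 * r)) l))
    * frobenius_euler r (n - l) lambda.
Proof.
have -> : frobenius_series lambda ^+ r =
    frobenius_series lambda ^+ (2 * r) * frobenius_euler_series lambda ^+ r.
  by rewrite mul2n -addnn exprD -mulrA -exprMn frobenius_seriesK expr1n mulr1.
by rewrite fact_coefsM big_mkord.
Qed.

(** For [l <= minn (2 * r) n] the upper limit [l] for [m] is at least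
    [minn (2 * r) l], and a larger [l <= n] forces [minn (2 * r) n = 2 * r]. *)
Lemma frobenius_power_euler_split n r :
  \sum_(0 <= l < (minn (2 * r) n).+1)
      ('C(n, l)%:R
       * \sum_(0 <= m < l.+1)
           'C(2 * r, m)%:R / (1 - lambda) ^+ m * multinomial_sum F m l)
      * frobenius_euler r (n - l) lambda
    + \sum_((minn (2 * r) n).+1 <= l < n.+1)
      ('C(n, l)%:R
       * \sum_(0 <= m < (minn (2 * r) n).+1)
           'C(2 * r, m)%:R / (1 - lambda) ^+ m * multinomial_sum F m l)
      * frobenius_euler r (n - l) lambda
  = n`!%:R * (frobenius_series lambda ^+ r) n.
Proof.
rewrite frobenius_power_euler.
rewrite [RHS](big_cat_nat (n := (minn (2 * r) n).+1)) ?ltnS ?geq_minr//=.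
congr (_ + _); apply: eq_big_nat => l /andP[l_ge l_lt].
  by rewrite frobenius_powerE// ltnS geq_minr.
rewrite frobenius_powerE// ltnS leq_min geq_minl /= geq_min.
move: l_ge; rewrite gtn_min => /orP[/ltnW rl|nl].
  by rewrite (leq_trans rl).
by move: l_lt; rewrite ltnS leqNgt nl.
Qed.

End Neq1.
End Exponential.

Theorem theorem5 (R : realType) (lambda : R[i]) (hlambda : lambda != 1)
    (n r : nat) :
  [/\ r`!%:R / (1 - lambda) ^+ r * stirling lambda n r
      = r`!%:R / (1 - lambda) ^+ r
        * (iter r (delta lambda) (fun x => x ^+ n) 0 / r`!%:R),

      r`!%:R / (1 - lambda) ^+ r
        * (iter r (delta lambda) (fun x => x ^+ n) 0 / r`!%:R)
      = \sum_(0 <= l < (minn (2 * r) n).+1)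
          ('C(n, l)%:R
           * \sum_(0 <= m < l.+1)
               'C(2 * r, m)%:R / (1 - lambda) ^+ m * multinomial_sum R[i] m l)
          * frobenius_euler r (n - l) lambda
        + \sum_((minn (2 * r) n).+1 <= l < n.+1)
          ('C(n, l)%:R
           * \sum_(0 <= m < (minn (2 * r) n).+1)
               'C(2 * r, m)%:R / (1 - lambda) ^+ m * multinomial_sum R[i] m l)
          * frobenius_euler r (n - l) lambda
    & \sum_(0 <= l < (minn (2 * r) n).+1)
          ('C(n, l)%:R
           * \sum_(0 <= m < l.+1)
               'C(2 * r, m)%:R / (1 - lambda) ^+ m * multinomial_sum R[i] m l)
          * frobenius_euler r (n - l) lambda
        + \sum_((minn (2 * r) n).+1 <= l < n.+1)
          ('C(n, l)%:R
           * \sum_(0 <= m < (minn (2 * r) n).+1)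
               'C(2 * r, m)%:R / (1 - lambda) ^+ m * multinomial_sum R[i] m l)
          * frobenius_euler r (n - l) lambda
      = \sum_(0 <= m < (minn r n).+1)
          'C(r, m)%:R / (1 - lambda) ^+ m * multinomial_sum R[i] m n].
Proof.
rewrite frobenius_power_euler_split// frobenius_power_delta//; split=> //.
  by rewrite stirling_delta frobenius_power_delta.
by rewrite frobenius_powerE.
Qed.
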